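(* Let $n\in\mathbb{N}$ and let $P$ be a real polynomial $$P(x)=a_0+a_1x+a_2\frac{x(x-1)}{2!}+\ldots+a_n\frac{x(x-1)\cdots(x-n+1)}{n!},$$ with $a_j>0$ for all $j=0,1,\ldots,n$. 1. Suppose that $$\frac{a_{k-1}^2}{a_{k-2}a_k}\ge 4\quad\text{for all } 2\le k\le n,\qquad\text{and}\qquad\frac{a_{n-1}}{a_n}\le 1.$$ Then $(P(k))_{k=0}^\infty\in\mathrm{TP}$. 2. Suppose that $n\ge 4$, that there exists $\alpha$ with $1+\sqrt5\le\alpha<4$ such that $$\frac{a_{k-1}^2}{a_{k-2}a_k}\in\left[\alpha,\frac{8}{\alpha(4-\alpha)}\right]\quad\text{for all } k=2,3,\ldots,n,$$ and that $\frac{a_{n-1}}{a_n}\le1$. Then $(P(k))_{k=0}^\infty\in\mathrm{TP}$.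
   Context: A sequence of nonnegative real numbers $(b_k)_{k=0}^\infty$ is called totally positive if all minors of the infinite upper triangular Toeplitz matrix $\left(b_{j-i}\right)_{i,j=0}^{\infty}$ (with the convention $b_k=0$ for $k<0$) are nonnegative. $\mathrm{TP}$ denotes the set of all totally positive sequences. $\mathbb{N}=\{1,2,3,\dots\}$. *)

(* Defs.v *)
From mathcomp Require Import all_boot all_order all_algebra.
From mathcomp Require Import reals.

Set Implicit Arguments.
Unset Strict Implicit.
Unset Printing Implicit Defensive.

Import Order.TTheory GRing.Theory Num.Theory.
Local Open Scope ring_scope.

(* The test on [i <= j] is the convention b_k = 0 for k < 0: [j - i] truncates. *)
Definition toeplitz (R : realType) (b : nat -> R) (i j : nat) : R :=
  if (i <= j)%N then b (j - i)%N else 0.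

(* [r] and [c] select the rows and columns; selecting them in increasing order
   is what fixes the sign of the minor. *)
Definition toeplitz_minor (R : realType) (b : nat -> R) (m : nat)
    (r c : 'I_m -> nat) : R :=
  \det (\matrix_(p < m, q < m) toeplitz b (r p) (c q)).

Definition strictly_increasing (m : nat) (r : 'I_m -> nat) : Prop :=
  forall p q : 'I_m, (p < q)%N -> (r p < r q)%N.

Definition totally_positive (R : realType) (b : nat -> R) : Prop :=
  (forall k : nat, 0 <= b k) /\
  (forall (m : nat) (r c : 'I_m -> nat),
     strictly_increasing r -> strictly_increasing c ->
     0 <= toeplitz_minor b r c).

Definition newton_poly (R : realType) (n : nat) (a : nat -> R) : {poly R} :=
  \sum_(j < n.+1) (a j / (j`!)%:R) *: \prod_(i < j) ('X - (i%:R)%:P).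

(* Main.v *)
(* Since sum_k C(k, j) z^k = z^j / (1-z)^(j+1), the generating function of
   (P(k)) is A(z/(1-z)) / (1-z), where A = sum_j a_j X^j. If A has only real
   roots s_i, they are negative with sum - a_(n-1)/a_n >= -1, so every - s_i lies
   in [0, 1], and the sequence arises from a constant one by successive
   multiplications by z/(1-z) - s_i. Such a multiplication preserves total
   positivity: after subtracting neighbouring columns, each column of a new minor
   is a nonnegative combination of old columns, with weakly increasing ranges of
   indices for consecutive columns, and one expands by multilinearity.
   A has only real roots because (-1)^k A(- x_k) >= 0 at some points
   0 = x_0 < ... < x_n. For 0 < k < n one takes x_k with
   a_(k-1) x_k^(k-1) = a_(k+1) x_k^(k+1), except that in part 2 the points x_1 and
   x_(n-1) come from the double root of the worst-case quartic. *)
Require Import Defs.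
From mathcomp Require Import all_boot all_order all_algebra.
From mathcomp Require Import fingroup perm.
From mathcomp Require Import reals.
From mathcomp Require Import ring lra zify.

Set Implicit Arguments.
Unset Strict Implicit.
Unset Printing Implicit Defensive.

Import Order.TTheory GRing.Theory Num.Theory.
Local Open Scope ring_scope.

(** * Operations preserving total positivity *)

(** Multilinearity in the columns: in each Leibniz term the product of sums is distributed over all
    choices [f] of one summand per column. *)
Lemma det_sum_cols (R : comNzRingType) (m N : nat) (w : 'I_m -> 'I_N -> R)
    (M : 'I_m -> 'I_N -> R) :
  \det (\matrix_(p < m, q < m) \sum_(j < N) w q j * M p j) =
  \sum_(f : {ffun 'I_m -> 'I_N})
     (\prod_(q < m) w q (f q)) * \det (\matrix_(p < m, q < m) M p (f q)).
Proof.
rewrite -det_tr; under eq_bigr => f _ do rewrite -det_tr /determinant mulr_sumr.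
rewrite exchange_big /=; apply: eq_bigr => s _.
under eq_bigr => q _ do rewrite !mxE.
rewrite bigA_distr_bigA /= mulr_sumr; apply: eq_bigr => f _.
rewrite big_split /= mulrCA; congr (_ * (_ * _)).
by apply: eq_bigr => q _; rewrite !mxE.
Qed.

(** The partial sums arise by right multiplication with a unitriangular matrix. Hence a determinant
    may be computed from the differences of consecutive columns. *)
Lemma det_partial_sum_cols (R : comNzRingType) (m : nat) (M : 'I_m -> 'I_m -> R) :
  \det (\matrix_(p < m, q < m) \sum_(i < m | (i <= q)%N) M p i) =
  \det (\matrix_(p < m, q < m) M p q).
Proof.
pose U : 'M[R]_m := \matrix_(i, q) (i <= q)%N%:R.
have -> : \matrix_(p < m, q < m) \sum_(i < m | (i <= q)%N) M p i =
          (\matrix_(p < m, q < m) M p q) *m U.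
  apply/matrixP => p q; rewrite !mxE big_mkcond; apply: eq_bigr => i _.
  by rewrite !mxE; case: leqP; rewrite ?mulr1 ?mulr0.
rewrite det_mulmx -(det_tr U) (@det_trig _ _ U^T); last first.
  by apply/is_trig_mxP => i j ij; rewrite !mxE leqNgt ij.
by rewrite big1 ?mulr1 // => i _; rewrite /U !mxE leqnn.
Qed.

Lemma strictly_increasing_ge (m : nat) (f : 'I_m -> nat) :
  strictly_increasing f -> forall i : 'I_m, (i <= f i)%N.
Proof.
move=> hf [k hk]; elim: k hk => [|k IH] hk //=.
exact: leq_ltn_trans (IH (ltnW hk)) (hf (Ordinal (ltnW hk)) (Ordinal hk) (ltnSn k)).
Qed.

(** The inverse of [s] is increasing as well, and an increasing map never lies below the identity;
    apply this to both. *)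
Lemma strictly_increasing_perm (m : nat) (s : 'S_m) :
  strictly_increasing (fun i => nat_of_ord (s i)) -> s = 1%g.
Proof.
move=> hs; have hV : strictly_increasing (fun i => nat_of_ord ((s^-1)%g i)).
  move=> p q pq; rewrite ltnNge leq_eqVlt; apply/negP => /orP [/eqP/val_inj/perm_inj E|].
    by rewrite E ltnn in pq.
  by move/hs; rewrite !permKV ltnNge (ltnW pq).
apply/permP => i; rewrite perm1; apply/val_inj/eqP; rewrite eqn_leq.
rewrite (strictly_increasing_ge hs i) andbT.
by have := strictly_increasing_ge hV (s i); rewrite permK.
Qed.

Section TotalPositivity.
Variable R : realType.
Implicit Types u b : nat -> R.

Lemma eq_totally_positive u b :
  u =1 b -> totally_positive u -> totally_positive b.
Proof.
move=> E [u0 um]; split => [k|m r c hr hc]; first by rewrite -E.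
have -> : toeplitz_minor b r c = toeplitz_minor u r c; last exact: um.
by congr (\det _); apply/matrixP => i j; rewrite !mxE /toeplitz E.
Qed.

Lemma totally_positiveZ (x : R) u :
  0 <= x -> totally_positive u -> totally_positive (fun k => x * u k).
Proof.
move=> x0 [u0 um]; split => [k|m r c hr hc]; first exact: mulr_ge0.
have -> : toeplitz_minor (fun k => x * u k) r c = x ^+ m * toeplitz_minor u r c.
  rewrite /toeplitz_minor -detZ; congr (\det _); apply/matrixP => i j.
  by rewrite !mxE /toeplitz; case: ifP; rewrite ?mulr0.
by rewrite mulr_ge0 ?exprn_ge0 ?um.
Qed.

(** A nonzero Leibniz term forces [r p = c (s p)] for every [p]. As [r] and [c] increase, so does
    [s], and only the identity, of sign +1, contributes. *)
Lemma totally_positive_delta : totally_positive (fun k => (k == 0%N)%:R : R).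
Proof.
split => [k|m r c hr hc]; first exact: ler0n.
rewrite /toeplitz_minor /determinant sumr_ge0 // => s _.
have E p : (\matrix_(p < m, q < m)
    toeplitz (fun k => (k == 0)%:R : R) (r p) (c q)) p (s p) = (r p == c (s p))%:R.
  by rewrite mxE /toeplitz subn_eq0 [in RHS]eqn_leq; case: leqP.
under eq_bigr => p _ do rewrite E.
have [rc|/forallPn [p hp]] := boolP [forall p, r p == c (s p)]; last first.
  by rewrite (bigD1 p) //= (negbTE hp) mul0r mulr0.
suff -> : s = 1%g by rewrite odd_perm1 mul1r prodr_ge0 // => p _; exact: ler0n.
apply: strictly_increasing_perm => p q pq.
have := hr p q pq; rewrite (eqP (forallP rc p)) (eqP (forallP rc q)) => cpq.
rewrite ltnNge leq_eqVlt; apply/negP => /orP [/eqP/val_inj E'|/hc].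
  by rewrite E' ltnn in cpq.
by rewrite ltnNge (ltnW cpq).
Qed.

(** Either two columns coincide and the determinant vanishes, or [f] is strictly increasing and the
    determinant is a genuine minor. *)
Lemma totally_positive_ge0_cols u m N (r : 'I_m -> nat) (f : 'I_m -> 'I_N) :
  totally_positive u -> strictly_increasing r ->
  (forall p q : 'I_m, (p < q)%N -> (f p <= f q)%N) ->
  0 <= \det (\matrix_(p < m, q < m) toeplitz u (r p) (f q)).
Proof.
move=> [_ um] hr hf.
have [inj|] := boolP (injectiveb f); last first.
  move/injectivePn => [i [j ij E]]; rewrite -det_tr (determinant_alternate ij) //.
  by move=> p; rewrite !mxE E.
apply: (um _ r (fun q => nat_of_ord (f q))) => // p q pq.
rewrite ltn_neqAle hf // andbT; apply/negP => /eqP/val_inj/(injectiveP _ inj) E.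
by rewrite E ltnn in pq.
Qed.

(* Multiplies the generating function of [u] by z/(1-z) + x. *)
Definition shift_sum (x : R) u (k : nat) : R := \sum_(i < k) u i + x * u k.

(** Column [j] of the new Toeplitz matrix is [x] times the old column [j] plus all earlier old
    columns. The bound [N] gives all columns of a minor a common index range. *)
Lemma toeplitz_shift_sum x u i N j : (j < N)%N ->
  toeplitz (shift_sum x u) i j =
  \sum_(l < N) ((l < j)%N%:R + x * (l == j :> nat)%:R) * toeplitz u i l.
Proof.
move=> jN; under eq_bigr => l _ do rewrite mulrDl.
rewrite big_split /= [X in _ + X](bigD1 (Ordinal jN)) //= eqxx mulr1.
rewrite [X in _ + (_ + X)]big1 ?addr0; last first.
  by move=> l lj; rewrite (_ : (l == j :> nat) = false) ?mulr0 ?mul0r //; apply/negbTE.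
have -> : \sum_(l < N) (l < j)%N%:R * toeplitz u i l = \sum_(l < j) toeplitz u i l.
  rewrite (big_ord_widen _ (fun l => toeplitz u i l) (ltnW jN)) [RHS]big_mkcond.
  by apply: eq_bigr => l _; case: ltnP; rewrite ?mul1r ?mul0r.
rewrite /toeplitz /shift_sum; case: leqP => [ij|ji]; last first.
  rewrite mulr0 addr0 big1 // => l _.
  by rewrite leqNgt (ltn_trans (ltn_ord l) ji).
congr (_ + _); move: (subnKC ij); move: (j - i)%N => d <-.
rewrite big_split_ord /= [X in _ = X + _]big1 ?add0r => [|l _].
  by apply: eq_bigr => l _; rewrite leq_addr addKn.
by rewrite leqNgt ltn_ord.
Qed.

Lemma totally_positive_shift_sum x u :
  0 <= x <= 1 -> totally_positive u -> totally_positive (shift_sum x u).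
Proof.
move=> /andP [x0 x1] tu; have [u0 um] := tu; split => [k|m r c hr hc].
  by rewrite addr_ge0 ?mulr_ge0 ?sumr_ge0.
case: m r c hr hc => [|m] r c hr hc; first by rewrite /toeplitz_minor det_mx00.
pose N := (\max_(i < m.+1) c i).+1.
have cN i : (c i < N)%N by rewrite ltnS; exact: leq_bigmax.
pose W (j : nat) (l : 'I_N) : R := (l < j)%N%:R + x * (l == j :> nat)%:R.
(* Weights of the old columns in the difference of the new columns [q - 1] and [q]: 1 - x at
   [c (q - 1)], 1 strictly between, x at [c q], and 0 elsewhere. They are nonnegative because 0 <= x
   <= 1. Column 0 is left as it is. *)
pose w (q : 'I_m.+1) l : R :=
  W (c q) l - if (0 < q)%N then W (c (inord q.-1)) l else 0.
have prev (q : 'I_m.+1) : (0 < q)%N -> (c (inord q.-1) < c q)%N.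
  move=> q0; apply: hc; rewrite inordK; first by rewrite prednK.
  exact: leq_ltn_trans (leq_pred _) (ltn_ord q).
have w_ge0 q l : 0 <= w q l.
  rewrite /w /W; case: ifP => [/prev|_]; last first.
    by rewrite subr0 addr_ge0 ?mulr_ge0 ?ler0n.
  move: (c (inord q.-1)) (c q) (nat_of_ord l) => a b t ab.
  by case: (ltngtP t a); case: (ltngtP t b) => /=; try lia; rewrite ?subrr; lra.
have w_ub q l : w q l != 0 -> (l <= c q)%N.
  rewrite /w /W; apply: contraNT; rewrite -ltnNge => h.
  rewrite (gtn_eqF h) ltnNge (ltnW h) mulr0 add0r sub0r oppr_eq0.
  case: ifP => // /prev h'; have h2 := ltn_trans h' h.
  by rewrite (gtn_eqF h2) ltnNge (ltnW h2) mulr0 add0r.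
have w_lb (q : 'I_m.+1) l : (0 < q)%N -> w q l != 0 -> (c (inord q.-1) <= l)%N.
  move=> q0; rewrite /w /W q0; apply: contraNT; rewrite -ltnNge => h.
  have h2 := ltn_trans h (prev _ q0).
  by rewrite h h2 (ltn_eqF h) (ltn_eqF h2) mulr0 addr0 subrr.
have W_sum (q : 'I_m.+1) l : \sum_(i < m.+1 | (i <= q)%N) w i l = W (c q) l.
  case: q => q; elim: q => [|q IH] hq.
    rewrite (bigD1 (Ordinal hq)) //= big1 ?addr0 /w /= ?subr0 // => i /andP [i0].
    by move: i0; rewrite leqn0 => /eqP i0 /negP []; apply/eqP/val_inj.
  rewrite (bigD1 (Ordinal hq)) //= (eq_bigl (fun i : 'I_m.+1 => (i <= q)%N)); last first.
    by move=> i; rewrite -(inj_eq val_inj) /= andbC -ltn_neqAle ltnS.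
  rewrite (IH (ltnW hq)) /w /= (_ : inord q = Ordinal (ltnW hq)) ?subrK //.
  by apply/val_inj; rewrite /= inordK // ltnW.
rewrite /toeplitz_minor.
have -> : \matrix_(p < m.+1, q < m.+1) toeplitz (shift_sum x u) (r p) (c q) =
   \matrix_(p < m.+1, q < m.+1) \sum_(i < m.+1 | (i <= q)%N)
      \sum_(l < N) w i l * toeplitz u (r p) l.
  apply/matrixP => p q; rewrite !mxE (toeplitz_shift_sum _ _ _ (cN q)) exchange_big.
  by apply: eq_bigr => l _; rewrite -/(W _ _) -W_sum mulr_suml.
rewrite det_partial_sum_cols.
rewrite (det_sum_cols w (fun p l => toeplitz u (r p) (nat_of_ord l))).
apply: sumr_ge0 => f _; have [/eqP ->|h] := boolP (\prod_(q < m.+1) w q (f q) == 0).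
  by rewrite mul0r.
apply: mulr_ge0; first by apply: prodr_ge0 => q _; exact: w_ge0.
have hw q : w q (f q) != 0 by move/prodf_neq0: h => /(_ q isT).
apply: (totally_positive_ge0_cols (f := fun q => f q)) => // p q pq.
(* The supports of the weights give f p <= c p <= c (q - 1) <= f q. *)
apply: leq_trans (w_ub _ _ (hw p)) _.
have q0 : (0 < q)%N by exact: leq_ltn_trans pq.
apply: leq_trans (w_lb _ _ q0 (hw q)).
have iK : (inord q.-1 : 'I_m.+1) = q.-1 :> nat.
  by rewrite inordK // (leq_ltn_trans (leq_pred _) (ltn_ord q)).
have : (p <= (inord q.-1 : 'I_m.+1))%N by rewrite iK -ltnS prednK.
by rewrite leq_eqVlt => /orP [/eqP/val_inj ->|/hc /ltnW].
Qed.

(** * Newton expansions and multiplication by linear factors *)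

Definition newton_seq (p : {poly R}) (k : nat) : R := \sum_(j < size p) p`_j *+ 'C(k, j).

Lemma newton_seq_widen (p : {poly R}) N k :
  (size p <= N)%N -> newton_seq p k = \sum_(j < N) p`_j *+ 'C(k, j).
Proof.
move/subnKC <-; rewrite big_split_ord /= [X in _ = _ + X]big1 ?addr0 // => j _.
by rewrite nth_default ?mul0rn // leq_addr.
Qed.

(** Pascal's rule: both sides vanish at 0 and have the same increments. On generating functions, the
    factor 'X becomes z/(1-z). *)
Lemma newton_seqXM (p : {poly R}) k : newton_seq ('X * p) k = \sum_(i < k) newton_seq p i.
Proof.
have E i : newton_seq ('X * p) i = \sum_(j < size p) p`_j *+ 'C(i, j.+1).
  rewrite (newton_seq_widen (N := (size p).+1)); last first.
    by rewrite (leq_trans (size_polyMleq _ _)) // size_polyX.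
  rewrite big_ord_recl coefXM eqxx mul0rn add0r; apply: eq_bigr => j _.
  by rewrite coefXM.
elim: k => [|k IH]; first by rewrite big_ord0 E big1.
rewrite big_ord_recr /= -IH !E -big_split /=; apply: eq_bigr => j _.
by rewrite binS mulrnDr.
Qed.

Lemma newton_seqMXaddC (p : {poly R}) (x : R) :
  newton_seq (p * ('X + x%:P)) =1 shift_sum x (newton_seq p).
Proof.
move=> k; have sXp : (size ('X * p)%R <= (size p).+1)%N.
  by rewrite (leq_trans (size_polyMleq _ _)) // size_polyX.
rewrite /shift_sum -newton_seqXM mulrDr [p * 'X]mulrC [p * x%:P]mulrC mul_polyC.
rewrite (newton_seq_widen (N := (size p).+1)); last first.
  rewrite (leq_trans (size_polyD _ _)) // geq_max sXp.
  exact: leq_trans (size_scale_leq _ _) _.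
rewrite !(newton_seq_widen (N := (size p).+1)) // mulr_sumr -big_split /=.
by apply: eq_bigr => j _; rewrite coefD coefZ mulrnDl mulrnAr.
Qed.

Lemma totally_positive_newton_seq (x : R) (s : seq R) :
  0 <= x -> {in s, forall y, -1 <= y <= 0} ->
  totally_positive (newton_seq (x *: \prod_(y <- s) ('X - y%:P))).
Proof.
move=> x0; elim: s => [|y s IH] hs.
  (* The constant sequence 1 is itself [shift_sum 1] of the sequence 1, 0, 0, ... *)
  apply: (@eq_totally_positive (fun k => x * shift_sum 1 (fun k => (k == 0%N)%:R) k)).
    move=> k; rewrite big_nil (newton_seq_widen (N := 1)); last first.
      by rewrite (leq_trans (size_scale_leq _ _)) ?size_poly1.
    rewrite big_ord1 coefZ coef1 bin0 /shift_sum; case: k => [|k].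
      by rewrite big_ord0 add0r mul1r.
    by rewrite big_ord_recl big1 // mulr0 !addr0.
  apply: totally_positiveZ => //; apply: totally_positive_shift_sum.
    by rewrite ler01 lexx.
  exact: totally_positive_delta.
pose p := x *: \prod_(z <- s) ('X - z%:P).
have -> : x *: \prod_(z <- y :: s) ('X - z%:P) = p * ('X + (- y)%:P).
  by rewrite big_cons polyCN mulrC scalerAl.
apply: (@eq_totally_positive (shift_sum (- y) (newton_seq p))).
  by move=> k; rewrite newton_seqMXaddC.
apply: totally_positive_shift_sum.
  by have := hs y (mem_head _ _); lra.
by apply: IH => z zs; apply: hs; rewrite inE zs orbT.
Qed.

Lemma horner_newton_poly n (a : nat -> R) (k : nat) :
  (newton_poly n a).[k%:R] = newton_seq (\poly_(j < n.+1) a j) k.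
Proof.
rewrite (newton_seq_widen _ (size_poly _ _)) /newton_poly horner_sum.
apply: eq_bigr => j _; rewrite hornerZ horner_prod coef_poly ltn_ord.
have -> : \prod_(i < j) ('X - i%:R%:P).[k%:R] = (k ^_ j)%:R :> R.
  elim: (nat_of_ord j) => [|i IH]; first by rewrite big_ord0.
  rewrite big_ord_recr /= IH hornerXsubC ffactnSr natrM.
  (* The truncated difference k - i is the real one only for i <= k; beyond that the falling
     factorial is already 0. *)
  have [ik|ki] := leqP i k; first by rewrite natrB.
  by rewrite ffact_small // !mul0r.
by rewrite -bin_ffact natrM mulrCA divfK ?mulr_natl // pnatr_eq0 -lt0n fact_gt0.
Qed.

End TotalPositivity.

(** * Real-rootedness from weak sign alternation *)

(* Dividing by ['X - y], where [y] is a root between the two rightmost points,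
   and discarding one point at which the quotient need not alternate preserves
   the hypotheses; if [y] is the second point, that is the one to discard. *)
Lemma split_of_weak_alternation (R : rcfType) (n : nat) (p : {poly R}) (x : nat -> R) :
  size p = n.+1 ->
  (forall i, (i < n)%N -> x i.+1 < x i) ->
  (forall i, (i <= n)%N -> 0 <= (-1) ^+ i * p.[x i]) ->
  exists2 s : seq R, size s = n & p = lead_coef p *: \prod_(y <- s) ('X - y%:P).
Proof.
elim: n p x => [|n IH] p x sp dx alt.
  exists [::] => //; rewrite big_nil alg_polyC /lead_coef sp.
  exact/size1_polyC/eq_leq.
have [] := @poly_ivt _ p (x 1%N) (x 0%N); first exact/ltW/dx.
  have := alt 1%N isT; have := alt 0%N isT; rewrite expr0 expr1 mul1r mulN1r oppr_ge0.
  by move=> -> ->.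
move=> y /andP [y1 y0] /factor_theorem [q Eq].
have q0 : q != 0 by apply: contra_eq_neq sp => q0; rewrite Eq q0 mul0r size_poly0.
have sq : size q = n.+1.
  by move: sp; rewrite Eq size_Mmonic ?monicXsubC // size_XsubC addn2 => -[].
have Elq : lead_coef q = lead_coef p by rewrite Eq lead_coef_Mmonic ?monicXsubC.
suff [z dz altz] : exists2 z : nat -> R, (forall i, (i < n)%N -> z i.+1 < z i) &
    (forall i, (i <= n)%N -> 0 <= (-1) ^+ i * q.[z i]).
  have [s ss Es] := IH q z sq dz altz; exists (y :: s); first by rewrite /= ss.
  by rewrite big_cons mulrC scalerAl -Elq -Es.
(* To the left of [y] the removed factor is negative, which absorbs one power of -1. *)
have altq i : (i <= n)%N -> x i.+1 < y -> 0 <= (-1) ^+ i * q.[x i.+1].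
  move=> le_in xy; have := alt i.+1 le_in; rewrite Eq hornerM hornerXsubC exprS.
  rewrite mulN1r mulNr mulrA -mulrN opprB pmulr_lge0 // subr_gt0 //.
have lt1 i : (i < n)%N -> x i.+2 < x 1%N.
  elim: i => [|i IHi] h; first exact: dx.
  exact: lt_trans (dx _ _) (IHi (ltnW h)).
move: y1; rewrite le_eqVlt => /orP [/eqP y1|y1].
  exists (fun i => if i is i'.+1 then x i'.+2 else x 0%N).
    case=> [|i] hi; last exact: dx.
    by apply: lt_trans (dx 0%N _) => //; apply: dx.
  case=> [|i] hi; last by apply: (altq i.+1) => //; rewrite -y1 lt1.
  have := alt 0%N isT; rewrite Eq hornerM hornerXsubC !expr0 !mul1r.
  by rewrite pmulr_lge0 // subr_gt0 -y1 dx.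
(* Here [x 0] is discarded, which also covers the case that [y] equals [x 0]. *)
exists (fun i => x i.+1) => i hi; first exact: dx.
apply: altq => //; case: i hi => // i hi; exact: lt_trans (lt1 _ hi) y1.
Qed.

(** * Alternating sums of log-concave sequences *)

Section AlternatingSums.
Variable R : realFieldType.
Implicit Types (u : nat -> R) (q : R).

Definition alt_sum u (m : nat) : R := \sum_(i < m) (-1) ^+ i * u i.

Lemma alt_sumS u m : alt_sum u m.+1 = u 0%N - alt_sum (fun i => u i.+1) m.
Proof.
rewrite /alt_sum big_ord_recl expr0 mul1r -sumrN; congr (_ + _).
by apply: eq_bigr => i _; rewrite lift0 exprS mulN1r mulNr.
Qed.

(** Group the terms in consecutive pairs, each with nonnegative difference. *)
Lemma alt_sum_ge0 u m :
  (forall i, (i < m)%N -> 0 <= u i) ->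
  (forall i, (i.+1 < m)%N -> u i.+1 <= u i) -> 0 <= alt_sum u m.
Proof.
elim/ltn_ind: m u => -[|[|m]] IH u u0 du; rewrite ?alt_sumS.
- by rewrite /alt_sum big_ord0.
- by rewrite /alt_sum big_ord0 subr0 u0.
rewrite opprB addrA addrAC addr_ge0 ?subr_ge0 ?du //.
apply: IH => // i hi; [exact: u0 | exact: du].
Qed.

(** The lower bound on the quotients u_(i+1)^2 / (u_i u_(i+2)), cleared of denominators. These
    quotients do not change when u_j is multiplied by x^j. *)
Definition pos_log_concave q u (m : nat) : Prop :=
  (forall i, (i <= m)%N -> 0 < u i) /\
  (forall i, (i.+2 <= m)%N -> q * (u i * u i.+2) <= u i.+1 ^+ 2).

Lemma pos_log_concave_shift q u m k :
  pos_log_concave q u (k + m) -> pos_log_concave q (fun i => u (k + i)%N) m.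
Proof.
move=> [u0 uq]; split => i hi; first by apply: u0; rewrite leq_add2l.
by rewrite !addnS; apply: uq; rewrite -!addnS leq_add2l.
Qed.

Lemma pos_log_concave_rev q u k :
  pos_log_concave q u k -> pos_log_concave q (fun i => u (k - i)%N) k.
Proof.
move=> [u0 uq]; split => i hi; first by apply: u0; rewrite leq_subr.
have := uq (k - i.+2)%N; rewrite -!subSn ?subSS ?(ltnW hi) // ?ltnS; last by lia.
by move=> /(_ (leq_subr _ _)); rewrite [u (k - i)%N * _]mulrC.
Qed.

Lemma pos_log_concave_le q u k m :
  (k <= m)%N -> pos_log_concave q u m -> pos_log_concave q u k.
Proof.
by move=> km [u0 uq]; split => i hi; [apply: u0|apply: uq]; apply: leq_trans hi km.
Qed.

(** The ratios of consecutive terms do not increase, so all are at most 1 once the first is. *)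
Lemma pos_log_concave_nonincr q u m :
  1 <= q -> pos_log_concave q u m -> u 1%N <= u 0%N ->
  forall i, (i < m)%N -> u i.+1 <= u i.
Proof.
move=> q1 [u0 uq] u10; elim=> [//|i IH] hi.
have h1 := u0 _ hi; have h2 := u0 _ (ltnW hi); have h3 := u0 _ (ltnW (ltnW hi)).
have h := uq i hi; have h' := IH (ltnW hi).
have : u i.+2 * u i <= u i.+1 * u i.
  rewrite mulrC; apply: le_trans (_ : u i.+1 ^+ 2 <= _); last by rewrite expr2 ler_pM2l.
  apply: le_trans h; rewrite ler_peMl // mulr_ge0 ?ltW //.
by rewrite ler_pM2r.
Qed.

Lemma alt_sum_lb2 q u m :
  1 <= q -> (1 <= m)%N -> pos_log_concave q u m -> u 1%N <= u 0%N ->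
  u 0%N - u 1%N <= alt_sum u m.+1.
Proof.
case: m => // m q1 _ lc u10; rewrite !alt_sumS opprB addrA [_ - _ in leRHS]addrC.
rewrite [X in _ <= X](_ : _ = u 0%N - u 1%N + alt_sum (fun i => u i.+2) m); last by ring.
rewrite lerDl alt_sum_ge0 // => i hi; first by apply/ltW/(proj1 lc); lia.
by apply: (pos_log_concave_nonincr q1 lc) => //; lia.
Qed.

Lemma alt_sum_lb4 q u m :
  1 <= q -> (3 <= m)%N -> pos_log_concave q u m -> u 1%N <= u 0%N ->
  u 0%N - u 1%N + u 2%N - u 3%N <= alt_sum u m.+1.
Proof.
case: m => [|[|m]] // q1 hm lc u10; rewrite !alt_sumS.
have h := @alt_sum_lb2 q (fun i => u i.+2) m q1 hm (@pos_log_concave_shift q u m 2 lc).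
have := h (pos_log_concave_nonincr q1 lc u10 (i := 2) hm).
by rewrite alt_sumS; lra.
Qed.

(** Each ratio of consecutive terms is at most a third of the preceding one. Thus u_2/u_1 <= 1/3 and
    u_3/u_2 <= 1/9, whence u_2 - u_3 >= 8/9 u_2. *)
Lemma alt_sum_lb3 q u m :
  3 <= q -> (2 <= m)%N -> pos_log_concave q u m -> u 1%N <= u 0%N ->
  u 0%N - u 1%N + 8 / 9 * u 2%N <= alt_sum u m.+1.
Proof.
move=> q3 hm lc u10; have q1 : 1 <= q by lra.
have [u0 uq] := lc.
have ratio (t a b c : R) : 0 < a -> 0 < b -> 0 < c ->
    q * (a * c) <= b ^+ 2 -> b <= t * a -> 3 * c <= t * b.
  move=> a0 b0 c0 h bta; rewrite -(ler_pM2l a0).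
  apply: (@le_trans _ _ (q * (a * c))).
    by rewrite mulrCA ler_wpM2r // ltW // mulr_gt0.
  by rewrite (le_trans h) // expr2 mulrCA mulrA ler_pM2r.
have h1 : 3 * u 2%N <= 1 * u 1%N.
  by apply: (ratio _ (u 0%N)); rewrite ?mul1r ?u0 ?uq // ltnW.
have [m3|m2] := leqP 3 m.
  have h2 : 3 * u 3%N <= 3^-1 * u 2%N.
    apply: (ratio _ (u 1%N)); rewrite ?u0 ?uq //; [exact: ltnW|lra].
  by apply: le_trans (alt_sum_lb4 q1 m3 lc u10); lra.
have {m2 hm} E : m = 2 by lia.
rewrite E !alt_sumS /alt_sum big_ord0; have := u0 2%N; rewrite E => /(_ isT).
lra.
Qed.

(** Summing outward from index [k] in both directions makes each half start with +t_k, which is then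
    counted twice. The halves can be bounded below separately. *)
Lemma alt_sum_split (t : nat -> R) (n k : nat) : (k <= n)%N ->
  (-1) ^+ k * alt_sum t n.+1 =
  alt_sum (fun i => t (k - i)%N) k.+1 + alt_sum (fun i => t (k + i)%N) (n - k).+1 - t k.
Proof.
move/subnKC <-; move: (n - k)%N => {n} n; rewrite addKn.
have rev : alt_sum (fun i => t (k - i)%N) k.+1 = (-1) ^+ k * alt_sum t k.+1.
  rewrite /alt_sum (reindex_inj rev_ord_inj) mulr_sumr; apply: eq_bigr => -[j hj] _ /=.
  rewrite subSS subKn // mulrA; congr (_ * _); rewrite -{2}(subnK (hj : (j <= k)%N)).
  by rewrite exprD -mulrA -expr2 sqrr_sign mulr1.
have -> : alt_sum t (k + n).+1 =
    alt_sum t k.+1 + \sum_(i < n) (-1) ^+ (k.+1 + i) * t (k.+1 + i)%N.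
  by rewrite /alt_sum -addSn big_split_ord.
rewrite mulrDr -rev -addrA; congr (_ + _); rewrite alt_sumS addn0 addrAC subrr add0r.
rewrite mulr_sumr -sumrN; apply: eq_bigr => i _.
by rewrite addSnnS exprD !mulrA -expr2 sqrr_sign mul1r exprS mulN1r mulNr.
Qed.
End AlternatingSums.

(** * Points of sign alternation, and part 1 *)

Section Points.
Variable R : rcfType.
Implicit Types (a t : nat -> R) (q x : R).

Lemma pos_log_concave_monomials q a n x :
  0 < x -> pos_log_concave q a n -> pos_log_concave q (fun j => a j * x ^+ j) n.
Proof.
move=> x0 [a0 aq]; split => i hi; first by rewrite mulr_gt0 ?exprn_gt0 ?a0.
have -> : q * (a i * x ^+ i * (a i.+2 * x ^+ i.+2)) =
          (q * (a i * a i.+2)) * x ^+ i.+1 ^+ 2 by rewrite !exprS; ring.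
by rewrite exprMn ler_wpM2r ?aq // ?exprn_ge0 // ltW.
Qed.

Lemma horner_poly_opp a n x :
  (\poly_(j < n.+1) a j).[- x] = alt_sum (fun j => a j * x ^+ j) n.+1.
Proof.
rewrite horner_poly /alt_sum; apply: eq_bigr => j _.
by rewrite (exprNn x) mulrCA.
Qed.

(* The middle conditions put [x] in [a_(k-1)/a_k, a_k/a_(k+1)); these intervals are
   consecutive, so points for increasing [k] are increasing. *)
Definition alternation_point a n k x : Prop :=
  [/\ 0 < x, a k.-1 <= a k * x, a k.+1 * x < a k &
      0 <= (-1) ^+ k * alt_sum (fun j => a j * x ^+ j) n.+1].

(** Two points are added. At 0 the value is a_0 > 0. At x_n = a_(n-1)/a_n the two top terms cancel,
    and the others, read downwards, form an alternating sum of nonincreasing terms. *)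
Lemma split_of_alternation_points q a n (x : nat -> R) :
  1 <= q -> (1 <= n)%N -> pos_log_concave q a n ->
  (forall k, (0 < k < n)%N -> alternation_point a n k (x k)) ->
  exists2 s : seq R, size s = n &
    \poly_(j < n.+1) a j = a n *: \prod_(y <- s) ('X - y%:P).
Proof.
move=> q1 n1 lc hx; have [a0 _] := lc.
pose rho k := a k.-1 / a k.
have rho_gt0 k : (k <= n)%N -> 0 < rho k.
  by move=> kn; rewrite divr_gt0 ?a0 // (leq_trans (leq_pred _)).
pose X (i : nat) := if i == 0%N then 0 else if (i < n)%N then x i else rho n.
have X_ge i : (0 < i <= n)%N -> rho i <= X i.
  move=> /andP [i0 le_in]; rewrite /X (gtn_eqF i0); case: ltnP => h.
    have [_ h1 _ _] := hx i (introT andP (conj i0 h)).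
    by rewrite ler_pdivrMr ?a0 // mulrC.
  by rewrite (_ : i = n) //; lia.
have X_lt i : (0 < i < n)%N -> X i < rho i.+1.
  move=> hi; have /andP [i0 lt_in] := hi; rewrite /X (gtn_eqF i0) lt_in /rho /=.
  have [_ _ h1 _] := hx i hi.
  by rewrite ltr_pdivlMr ?a0 // mulrC.
have En : a n = lead_coef (\poly_(j < n.+1) a j).
  by rewrite lead_coef_poly // lt0r_neq0 // a0.
rewrite [a n]En; apply: (split_of_weak_alternation (x := fun i => - X i)).
- by rewrite size_poly_eq // lt0r_neq0 // a0.
- case=> [|i] hi; rewrite ltrN2; last exact: lt_le_trans (X_lt i.+1 hi) (X_ge i.+2 hi).
  by apply: lt_le_trans (X_ge 1%N hi); rewrite /X eqxx rho_gt0.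
move=> i hi; rewrite horner_poly_opp.
case: i hi => [|i] hi.
  rewrite /X eqxx expr0 mul1r alt_sumS expr0 mulr1 /alt_sum big1 ?subr0 ?ltW ?a0 //.
  by move=> j _; rewrite exprS mul0r !mulr0.
rewrite /X /=; case: ltnP => h; first by have [] := hx i.+1 h.
have {h hi} -> : i.+1 = n by lia.
have rn := rho_gt0 n (leqnn n).
have lct := pos_log_concave_monomials rn lc.
rewrite (@alt_sum_split _ _ n n) // subnn [alt_sum _ 1]alt_sumS [alt_sum _ 0]big_ord0.
rewrite subr0 addn0 addrK.
have E : a n.-1 * rho n ^+ n.-1 = a n * rho n ^+ n.
  have -> : rho n ^+ n = rho n * rho n ^+ n.-1 by rewrite -exprS prednK.
  by rewrite mulrA; congr (_ * _); rewrite /rho mulrCA divff ?mulr1 // lt0r_neq0 ?a0.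
have := alt_sum_lb2 q1 n1 (pos_log_concave_rev lct).
by rewrite /= subn0 subn1 E subrr => ->.
Qed.

(** The point is the geometric mean of b/c and c/d, and b/c < c/d because q > 1. *)
Lemma geometric_mean_point (b c d q : R) :
  1 < q -> 0 < b -> 0 < c -> 0 < d -> q * (b * d) <= c ^+ 2 ->
  [/\ 0 < Num.sqrt (b / d), b <= c * Num.sqrt (b / d), d * Num.sqrt (b / d) < c &
      d * Num.sqrt (b / d) ^+ 2 = b].
Proof.
move=> q1 b0 c0 d0 h; have bd0 : 0 < b / d by rewrite divr_gt0.
have E : d * Num.sqrt (b / d) ^+ 2 = b.
  by rewrite sqr_sqrtr ?ltW // mulrC divfK // lt0r_neq0.
have s0 : 0 < Num.sqrt (b / d) by rewrite sqrtr_gt0.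
move: (Num.sqrt (b / d)) s0 E => s s0 E.
have lt2 : d * s < c.
  rewrite -(@ltr_pXn2r _ 2) ?nnegrE ?ltW ?mulr_gt0 //.
  rewrite exprMn expr2 -mulrA E; apply: lt_le_trans h.
  by rewrite [d * b]mulrC ltr_pMl // mulr_gt0.
split => //; rewrite -E expr2 mulrA ler_pM2r //; exact: ltW.
Qed.

Lemma alternation_point_mid q a n k :
  1 < q -> (0 < k < n)%N -> pos_log_concave q a n ->
  (forall x, 0 < x ->
     let t j := a j * x ^+ j in t k.+1 = t k.-1 -> t k.-1 <= t k ->
     0 <= (-1) ^+ k * alt_sum t n.+1) ->
  alternation_point a n k (Num.sqrt (a k.-1 / a k.+1)).
Proof.
move=> q1 /andP [k0 kn] lc H; have [a0 aq] := lc.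
case: k k0 kn H => [//|k] _ kn /= H.
have := geometric_mean_point q1 (a0 _ (ltnW (ltnW kn)))
  (a0 _ (ltnW kn)) (a0 _ kn) (aq _ kn).
move: (Num.sqrt _) => x [x0 h1 h2 h3]; split => //; apply: H => //.
  by rewrite -h3 !exprS expr0; ring.
by rewrite exprS mulrA ler_pM2r ?exprn_gt0.
Qed.

(** Since t_(k-1) = t_(k+1), the bound 4 yields t_k >= 2 t_(k-1). The two halves contribute t_k -
    t_(k-1) each, and t_k is subtracted once. *)
Lemma alternation_point_ge4 a n k :
  (0 < k < n)%N -> pos_log_concave 4 a n ->
  alternation_point a n k (Num.sqrt (a k.-1 / a k.+1)).
Proof.
move=> hk lc; apply: (@alternation_point_mid 4) => //; first by lra.
move=> x x0 t tE le_t; have [k0 kn] := andP hk.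
have lct : pos_log_concave 4 t n by exact: pos_log_concave_monomials.
have q1 : 1 <= 4 :> R by lra.
have [t0 tq] := lct.
have tk : 2 * t k.-1 <= t k.
  have := tq k.-1; rewrite !prednK // tE => /(_ kn) h.
  have h1 := t0 k.-1 (leq_trans (leq_pred _) (ltnW kn)).
  have h2 := t0 k (ltnW kn); rewrite leNgt; apply/negP => h3; nra.
rewrite (alt_sum_split _ (ltnW kn)).
have := alt_sum_lb2 q1 k0 (pos_log_concave_rev (pos_log_concave_le (ltnW kn) lct)).
rewrite subn0 subn1 => /(_ le_t) h1.
have lc' : pos_log_concave 4 t (k + (n - k)) by rewrite subnKC // ltnW.
have := alt_sum_lb2 q1 (m := n - k) _ (pos_log_concave_shift lc').
rewrite addn0 addn1 tE subn_gt0 => /(_ kn le_t) h2.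
lra.
Qed.

(** Here T = t_k, y = t_(k-1) = t_(k+1), and w, w' are the terms two steps away. After
    multiplication by T, the lower bounds on w and w' contribute [g]; then 2yT <= T^2 + g is squared
    and g^2 dropped. *)
Lemma mid_term_ineq (al T y w w' : R) :
  3 <= al -> al < 4 -> 0 < T -> 0 < y -> al * y ^+ 2 <= T ^+ 2 ->
  al * (4 - al) * y ^+ 2 <= 8 * (T * w) -> al * (4 - al) * y ^+ 2 <= 8 * (T * w') ->
  0 <= T - 2 * y + 8 / 9 * (w + w').
Proof.
move=> al3 al4 T0 y0 hT hw hw'; rewrite -(pmulr_rge0 _ T0).
pose g := 2 / 9 * al * (4 - al) * y ^+ 2.
have g0 : 0 <= g by rewrite /g; apply: mulr_ge0; [nra | exact: exprn_ge0 (ltW y0)].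
suff : 2 * y * T <= T ^+ 2 + g by rewrite /g; nra.
have Y0 : 0 < y ^+ 2 by exact: exprn_gt0.
have X0 : 0 < T ^+ 2 by exact: exprn_gt0.
have yT : 0 <= 2 * y * T by rewrite !mulr_ge0 // ltW.
have Tg : 0 <= T ^+ 2 + g by rewrite addr_ge0 // ltW.
rewrite -(@ler_pXn2r _ 2) ?nnegrE //.
have -> : (2 * y * T) ^+ 2 = 4 * y ^+ 2 * T ^+ 2 by ring.
apply: (@le_trans _ _ ((T ^+ 2 + 2 * g) * T ^+ 2)); last by nra.
rewrite ler_pM2r //; apply: (@le_trans _ _ (al * y ^+ 2 + 2 * g)); last by rewrite lerD2r.
have -> : al * y ^+ 2 + 2 * g = al * (1 + 4 / 9 * (4 - al)) * y ^+ 2 by rewrite /g; ring.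
(* What remains is equivalent to (4 al - 9)(4 - al) >= 0. *)
rewrite ler_pM2r //; nra.
Qed.

(* With m = al (4 - al) v^2 t1 / 8, the least possible [t3], and extremal [t0] and
   [t4], the right-hand side times - al v / t1 is a perfect square that vanishes by
   the choice of [v]. *)
Lemma end_term_ineq (al v t0 t1 t2 t3 t4 : R) :
  3 <= al -> al < 4 -> 0 < v -> v <= 1 ->
  al * (4 - al) * v ^+ 2 - 4 * al * v + 8 = 0 ->
  0 < t1 -> 0 < t3 -> t2 = v * t1 ->
  al * (t0 * t2) <= t1 ^+ 2 -> al * (t1 * t3) <= t2 ^+ 2 -> al * (t2 * t4) <= t3 ^+ 2 ->
  al * (4 - al) * t2 ^+ 2 <= 8 * (t1 * t3) ->
  0 <= t1 - t0 - t2 + t3 - t4.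
Proof.
move=> al3 al4 v0 v1 hv t1_gt0 t3_gt0 -> h0 h1 h2 h3.
have av0 : 0 < al * v by apply: mulr_gt0 => //; lra.
have h0' : al * v * t0 <= t1.
  by rewrite -(ler_pM2r t1_gt0) -expr2; apply: le_trans h0; lra.
have h1' : al * t3 <= v ^+ 2 * t1.
  by rewrite -(ler_pM2r t1_gt0); move: h1; rewrite exprMn expr2; lra.
have h3' : al * (4 - al) * v ^+ 2 * t1 <= 8 * t3.
  by rewrite -(ler_pM2r t1_gt0); move: h3; rewrite !exprMn !expr2; lra.
rewrite -(pmulr_rge0 _ av0) -(pmulr_rge0 _ t1_gt0).
pose m := al * (4 - al) * v ^+ 2 * t1 / 8.
have m0 : 0 < m.
  rewrite /m; do ! apply: mulr_gt0 => //; try lra.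
have mt : m <= t3 by rewrite /m; lra.
have key : t1 * (al * v * (t1 - v * t1) - t1) + al * v * t1 * m - m ^+ 2 = 0.
  (* This is the equation for [v], solved for [m]. *)
  have E : m = t1 * (al * v / 2 - 1).
    have : t1 * (al * (4 - al) * v ^+ 2 - 4 * al * v + 8) = 0 by rewrite hv mulr0.
    by rewrite /m; lra.
  by rewrite E -[RHS](mulr0 (- t1 ^+ 2 / 4)) -hv; field.
(* The quadratic s (al v t1 - s) does not decrease from [m] to [t3], since m + t3 <= 2 t3 <= al v
   t1. *)
have mono : al * v * t1 * m - m ^+ 2 <= al * v * t1 * t3 - t3 ^+ 2.
  have : 0 <= (t3 - m) * (al * v * t1 - t3 - m).
    apply: mulr_ge0; first by rewrite subr_ge0.
    have : v ^+ 2 * t1 <= v * t1 by rewrite ler_pM2r // expr2 ler_piMl // ltW.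
    have : 0 < v * t1 by exact: mulr_gt0.
    move: (v * t1) (v ^+ 2 * t1) h1' (mulrA al v t1) => z z' h1' <- z0 zz.
    nra.
  nra.
nra.
Qed.

End Points.

(** * Evaluation points for part 2 *)

Section EvaluationPoints.
Variable R : rcfType.
Implicit Types (a t : nat -> R) (al v x : R).

(* The condition a_(i+1)^2 / (a_i a_(i+2)) <= 8 / (al (4 - al)). *)
Definition log_concavity_le al a n : Prop :=
  forall i, (i.+2 <= n)%N -> al * (4 - al) * a i.+1 ^+ 2 <= 8 * (a i * a i.+2).

Lemma log_concavity_le_monomials al a n x :
  0 < x -> log_concavity_le al a n -> log_concavity_le al (fun j => a j * x ^+ j) n.
Proof.
move=> x0 aq i hi /=.
have -> : 8 * (a i * x ^+ i * (a i.+2 * x ^+ i.+2)) =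
          (8 * (a i * a i.+2)) * x ^+ i.+1 ^+ 2 by rewrite !exprS; ring.
by rewrite exprMn [leLHS]mulrA ler_wpM2r ?aq // ?exprn_ge0 // ltW.
Qed.

(** With two neighbours on each side, both halves admit the bound with the 8/9 term, and the sum of
    the two bounds is the expression of [mid_term_ineq]. *)
Lemma alternation_point_inner al a n k :
  3 <= al -> al < 4 -> (2 <= k)%N -> (k.+2 <= n)%N ->
  pos_log_concave al a n -> log_concavity_le al a n ->
  alternation_point a n k (Num.sqrt (a k.-1 / a k.+1)).
Proof.
move=> al3 al4 k2 kn lc ub; have kn' : (k < n)%N by exact: ltnW.
apply: (@alternation_point_mid _ al) => //; first by lra.
  by rewrite kn' (ltnW k2).
move=> x x0 t tE le_t.
have lct : pos_log_concave al t n by exact: pos_log_concave_monomials.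
have ubt : log_concavity_le al t n by exact: log_concavity_le_monomials.
have [t0 tq] := lct.
rewrite (alt_sum_split _ (ltnW kn')).
have := alt_sum_lb3 al3 k2 (pos_log_concave_rev (pos_log_concave_le (ltnW kn') lct)).
rewrite subn0 subn1 => /(_ le_t) h1.
have lc' : pos_log_concave al t (k + (n - k)) by rewrite subnKC // ltnW.
have nk : (2 <= n - k)%N by lia.
have := alt_sum_lb3 al3 nk (pos_log_concave_shift lc').
rewrite addn0 addn1 addn2 tE => /(_ le_t) h2.
have : 0 <= t k - 2 * t k.-1 + 8 / 9 * (t (k - 2)%N + t k.+2).
  case: k {kn'} k2 kn tE le_t {h1 h2 nk lc'} => [|[|k]] //= _ kn tE le_t.
  rewrite subSS subSS subn0; have hk : (k.+2 <= n)%N by lia.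
  apply: (mid_term_ineq al3 al4); rewrite ?t0 //; try lia.
  - by have := tq _ (ltnW kn); rewrite tE -expr2.
  - by rewrite [t k.+2 * _]mulrC; apply: ubt.
  by rewrite -tE; apply: ubt.
lra.
Qed.

(** The quadratic equals 8 at 0 and 8 - al^2 < 0 at 1. At a root, 4 al v >= 8, hence al v >= 2. *)
Lemma end_ratio_exists al : 3 <= al -> al < 4 ->
  exists2 v, 0 < v < 1 /\ 1 < al * v & al * (4 - al) * v ^+ 2 - 4 * al * v + 8 = 0.
Proof.
move=> al3 al4.
pose p : {poly R} := - ((al * (4 - al)) *: 'X^2 - (4 * al) *: 'X + 8%:P).
have pE v : p.[v] = - (al * (4 - al) * v ^+ 2 - 4 * al * v + 8).
  by rewrite /p !hornerE.
have [] := @poly_ivt _ p 0 1 ler01.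
  by rewrite !pE; apply/andP; split; nra.
move=> v /andP [v0 v1]; rewrite /root pE oppr_eq0 => /eqP hv; exists v => //.
have v0' : v != 0.
  by apply/eqP => E; move: hv; rewrite E; lra.
have v1' : v != 1.
  by apply/eqP => E; move: hv; rewrite E; nra.
have vp : 0 < v by rewrite lt_def v0' v0.
have vl : v < 1 by rewrite lt_neqAle v1'.
split; first by rewrite vp.
have : 0 <= al * (4 - al) * v ^+ 2 by rewrite mulr_ge0 ?exprn_ge0 // mulr_ge0; lra.
lra.
Qed.

(** Only t_0 precedes t_1, so neighbours are not balanced; instead the point makes t_2 = v t_1. The
    halves are bounded by t_1 - t_0 and t_1 - t_2 + t_3 - t_4. *)
Lemma alternation_point_first al v a n :
  3 <= al -> al < 4 -> (4 <= n)%N -> 0 < v < 1 -> 1 < al * v ->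
  al * (4 - al) * v ^+ 2 - 4 * al * v + 8 = 0 ->
  pos_log_concave al a n -> log_concavity_le al a n ->
  alternation_point a n 1 (v * a 1%N / a 2%N).
Proof.
move=> al3 al4; case: n => [|[|[|[|n]]]] // _ /andP [v0 v1] av hv lc ub.
have [a0 aq] := lc.
have [a0_gt0 a1_gt0 a2_gt0] : [/\ 0 < a 0%N, 0 < a 1%N & 0 < a 2%N] by split; apply: a0.
set x := v * _ / _.
have x0 : 0 < x by rewrite divr_gt0 ?mulr_gt0.
have xE : a 2%N * x = v * a 1%N by rewrite /x mulrC divfK // lt0r_neq0.
(* Indeed a_0 a_2 <= a_1^2 / al <= v a_1^2, because al v > 1. *)
have le1 : a 0%N <= a 1%N * x.
  rewrite -(ler_pM2r a2_gt0) -mulrA [x * _]mulrC xE.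
  have := aq 0%N isT; have : 0 < a 0%N * a 2%N by exact: mulr_gt0.
  move: (a 0%N * _) => z z0 hz.
  rewrite mulrCA -expr2.
  have : v * (al * z) <= v * a 1%N ^+ 2 by rewrite ler_pM2l.
  have : z <= al * v * z by rewrite ler_peMl // ltW.
  by lra.
split=> //; first by rewrite xE gtr_pMl.
pose t j := a j * x ^+ j.
have lct : pos_log_concave al t n.+4 by exact: pos_log_concave_monomials.
have ubt : log_concavity_le al t n.+4 by exact: log_concavity_le_monomials.
have [t0 tq] := lct.
rewrite -/t (alt_sum_split _ (isT : (1 <= n.+4)%N)).
have q1 : 1 <= al by lra.
have t2E : t 2%N = v * t 1%N by rewrite /t expr1 expr2 mulrA xE mulrA.
have := alt_sum_lb2 (m := 1) q1 isT
  (pos_log_concave_rev (pos_log_concave_le (isT : (1 <= n.+4)%N) lct)).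
rewrite subn0 subnn => h1.
rewrite subn1 /=; have lc' : pos_log_concave al t (1 + n.+3) by [].
have := alt_sum_lb4 (m := n.+3) q1 isT (pos_log_concave_shift lc').
rewrite addn0 !add1n t2E ger_pMl ?t0 // (ltW v1) => /(_ isT) h2.
have : 0 <= t 1%N - t 0%N - t 2%N + t 3%N - t 4%N.
  apply: (end_term_ineq al3 al4 v0 (ltW v1) hv) => //; rewrite ?t0 ?tq ?ubt //.
have : t 0%N <= t 1%N by rewrite /t expr0 mulr1 expr1.
by move/h1; lra.
Qed.

(** Mirror image of the first point under reversal of the coefficients: now t_(n-2) = v t_(n-1), and
    the terms t_n, ..., t_(n-4) take the places of t_0, ..., t_4. *)
Lemma alternation_point_last al v a n :
  3 <= al -> al < 4 -> (4 <= n)%N -> 0 < v < 1 -> 1 < al * v ->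
  al * (4 - al) * v ^+ 2 - 4 * al * v + 8 = 0 ->
  pos_log_concave al a n -> log_concavity_le al a n ->
  alternation_point a n n.-1 (a n.-2 / (v * a n.-1)).
Proof.
move=> al3 al4; case: n => [|[|[|[|n]]]] //= _ /andP [v0 v1] av hv lc ub.
have [a0 aq] := lc.
have [a0_gt0 a1_gt0 a2_gt0] : [/\ 0 < a n.+2, 0 < a n.+3 & 0 < a n.+4].
  by split; apply: a0; rewrite // !ltnS ?leqnSn // leqW.
set x := _ / (v * _).
have x0 : 0 < x by rewrite divr_gt0 ?mulr_gt0.
have xE : v * (a n.+3 * x) = a n.+2.
  by rewrite mulrA /x mulrC divfK // lt0r_neq0 // mulr_gt0.
have ax0 : 0 < a n.+3 * x by exact: mulr_gt0.
have lt1 : a n.+4 * x < a n.+3.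
  rewrite -(ltr_pM2r ax0) -(ltr_pM2l v0).
  have h := aq n.+2 (leqnn _).
  have z0 : 0 < a n.+4 * x by exact: mulr_gt0.
  have -> : v * (a n.+4 * x * (a n.+3 * x)) = (a n.+2 * a n.+4) * x by rewrite -xE; ring.
  have -> : v * (a n.+3 * (a n.+3 * x)) = v * a n.+3 ^+ 2 * x by ring.
  rewrite ltr_pM2r //.
  have : v * (al * (a n.+2 * a n.+4)) <= v * a n.+3 ^+ 2 by rewrite ler_pM2l.
  have : a n.+2 * a n.+4 < al * v * (a n.+2 * a n.+4) by rewrite ltr_pMl // mulr_gt0.
  by lra.
split => //=; first by rewrite -xE ger_pMl // ltW.
pose t j := a j * x ^+ j.
have lct : pos_log_concave al t n.+4 by exact: pos_log_concave_monomials.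
have ubt : log_concavity_le al t n.+4 by exact: log_concavity_le_monomials.
have [t0 tq] := lct.
rewrite -/t (alt_sum_split _ (leqnSn n.+3)).
have q1 : 1 <= al by lra.
have t2E : t n.+2 = v * t n.+3 by rewrite /t -xE (exprS x n.+2); ring.
have := alt_sum_lb4 (m := n.+3) q1 isT
  (pos_log_concave_rev (pos_log_concave_le (leqnSn n.+3) lct)).
rewrite !subSS !subn0 t2E ger_pMl ?t0 // (ltW v1) => /(_ isT) h1.
have lc' : pos_log_concave al t (n.+3 + 1) by rewrite addn1.
have := alt_sum_lb2 (m := 1) q1 isT (pos_log_concave_shift lc').
rewrite addn0 addn1 subSn // subnn => h2.
have : 0 <= t n.+3 - t n.+4 - t n.+2 + t n.+1 - t n.
  apply: (end_term_ineq al3 al4 v0 (ltW v1) hv) => //; rewrite ?t0 ?ltnS ?leqW //.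
  - by rewrite [t n.+4 * _]mulrC tq.
  - by rewrite [_ * t n.+1]mulrC tq.
  - by rewrite [_ * t n]mulrC tq // ltnW.
  by rewrite [_ * t n.+1]mulrC ubt.
have : t n.+4 <= t n.+3 by rewrite /t exprS mulrA ler_pM2r ?exprn_gt0 // ltW.
by move/h2; lra.
Qed.

End EvaluationPoints.

(** * From real roots to total positivity *)

Lemma totally_positive_of_split (R : realType) (n : nat) (a : nat -> R) (s : seq R) :
  (1 <= n)%N -> (forall j, (j <= n)%N -> 0 < a j) -> a (n - 1)%N / a n <= 1 ->
  size s = n -> \poly_(j < n.+1) a j = a n *: \prod_(y <- s) ('X - y%:P) ->
  totally_positive (fun k : nat => (newton_poly n a).[k%:R]).
Proof.
move=> n1 a0 le1 ss Es.
have neg : {in s, forall y, y <= 0}.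
  move=> y ys; rewrite leNgt; apply/negP => y0.
  have : root (\poly_(j < n.+1) a j) y by rewrite Es rootZ ?root_prod_XsubC // lt0r_neq0 ?a0.
  rewrite /root horner_poly big_ord_recl expr0 mulr1; apply/negP/lt0r_neq0.
  rewrite ltr_wpDr ?a0 // sumr_ge0 // => j _.
  by rewrite mulr_ge0 ?exprn_ge0 // ltW // a0 // ltn_ord.
have sumE : - \sum_(y <- s) y = a (n - 1)%N / a n.
  rewrite -coefPn_prod_XsubC ?ss -?lt0n //.
  have : (\poly_(j < n.+1) a j)`_n.-1 = a n.-1 by rewrite coef_poly ltnS leq_pred.
  by rewrite Es coefZ subn1 => <-; rewrite mulrAC divff ?mul1r // lt0r_neq0 ?a0.
apply: (@eq_totally_positive _ (newton_seq (\poly_(j < n.+1) a j))).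
  by move=> k; rewrite horner_newton_poly.
rewrite Es; apply: totally_positive_newton_seq; first exact/ltW/a0.
(* All roots are nonpositive, so each is at least their sum, which by Vieta is -a_(n-1)/a_n >=
   -1. *)
move=> y ys; rewrite neg // andbT; apply: le_trans (_ : \sum_(z <- s) z <= _).
  by rewrite lerNl sumE.
rewrite (big_rem y) //= gerDl big_seq sumr_le0 // => z /mem_rem zs.
exact: neg.
Qed.

Theorem theorem4p1 (R : realType) (n : nat) (a : nat -> R) (P : {poly R})
    (hn : (1 <= n)%N)
    (hP : P = newton_poly n a)
    (ha : forall j : nat, (j <= n)%N -> 0 < a j) :
  ((forall k : nat, (2 <= k <= n)%N ->
      4 <= a (k - 1)%N ^+ 2 / (a (k - 2)%N * a k)) ->
   a (n - 1)%N / a n <= 1 ->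
   totally_positive (fun k : nat => P.[k%:R]))
  /\
  ((4 <= n)%N ->
   (exists alpha : R,
      [/\ 1 + Num.sqrt 5 <= alpha, alpha < 4 &
          forall k : nat, (2 <= k <= n)%N ->
            a (k - 1)%N ^+ 2 / (a (k - 2)%N * a k)
              \in `[alpha, 8 / (alpha * (4 - alpha))]]) ->
   a (n - 1)%N / a n <= 1 ->
   totally_positive (fun k : nat => P.[k%:R])).
Proof.
have lc_of q : (forall k : nat, (2 <= k <= n)%N ->
      q <= a (k - 1)%N ^+ 2 / (a (k - 2)%N * a k)) -> pos_log_concave q a n.
  move=> h; split=> // i hi; have := h i.+2 hi.
  rewrite subn1 subn2 /= ler_pdivlMr // mulr_gt0 // ha //.
  exact: ltnW (ltnW hi).
rewrite hP; split => [hq le1|n4 [al [al5 al4 hq]] le1].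
  have q1 : 1 <= 4 :> R by lra.
  have [k hk|s ss Es] := split_of_alternation_points q1 hn (lc_of _ hq)
    (x := fun k => Num.sqrt (a k.-1 / a k.+1)).
    exact: alternation_point_ge4 hk (lc_of _ hq).
  exact: totally_positive_of_split Es.
have al3 : 3 <= al.
  apply: le_trans al5; have : Num.sqrt 4 <= Num.sqrt 5 :> R by rewrite ler_sqrt; lra.
  have -> : 4 = 2 ^+ 2 :> R by ring.
  by rewrite sqrtr_sqr ger0_norm; lra.
have lc : pos_log_concave al a n.
  by apply: lc_of => k hk; have := hq k hk; rewrite in_itv /= => /andP [].
have ub : log_concavity_le al a n.
  move=> i hi; have := hq i.+2 hi; rewrite in_itv /= subn1 subn2 /= => /andP [_].
  have d0 : 0 < a i * a i.+2 by rewrite mulr_gt0 // ha // ltnW // ltnW.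
  have c0 : 0 < al * (4 - al) by apply: mulr_gt0; lra.
  by rewrite ler_pdivrMr // mulrAC ler_pdivlMr // mulrC.
have [v [v01 av] hv] := end_ratio_exists al3 al4.
have q1 : 1 <= al by lra.
(* As n >= 4, the indices 1 and n - 1 differ, and every other index has two neighbours on each
   side. *)
pose x k := if k == 1%N then v * a 1%N / a 2%N else
            if k == n.-1 then a n.-2 / (v * a n.-1) else Num.sqrt (a k.-1 / a k.+1).
have [k hk|s ss Es] := split_of_alternation_points q1 hn lc (x := x); last first.
  exact: totally_positive_of_split Es.
rewrite /x; case: eqP => [->|k1]; first exact: (alternation_point_first al3 al4 n4 v01 av hv).
case: eqP => [->|kn]; first exact: (alternation_point_last al3 al4 n4 v01 av hv).
apply: (alternation_point_inner al3 al4) => //; clear -hk k1 kn; lia.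
Qed.
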